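(* Let $0\le q\le 1/2$ and consider the type II binary symmetric wiretap channel BSC-WT($q$), whose main channel is noiseless and whose eavesdropper channel is a binary symmetric channel with crossover probability $q$. Let $\{\mathcal{C}(n)\}$ be a good binary linear code sequence of rate $R_c$ with erasure rate threshold $\delta^{\star}$ for binary erasure channels. Let $\mathcal{C}_0(n)=\{0,1\}^n$ and $\mathcal{C}_1(n)=\mathcal{C}^{\perp}(n)$. Suppose the secure nested code sequence $\{\mathcal{C}_0(n),\mathcal{C}_1(n)\}$ is used over BSC-WT($q$). If $q\ge(1-\delta^{\star})/2$, then the rate-equivocation pair $(R,R_e)=(R_c,R_c)$ is achievable.
   Context: A binary linear code sequence $\{\mathcal{C}(n)\}$ consists of $(n,k_n)$ binary linear codes with common rate $R_c=k_n/n$; it is good if it achieves arbitrarily small word error probability over a noisy channel at nonzero rate. Its erasure rate threshold $\delta^\star$ is the worst-case (largest) erasure probability of a binary erasure channel at which the word error probability (under maximum-likelihood decoding) tends to zero as $n\to\infty$. Dual code: $\mathcal{C}^\perp(n)=\{\mathbf{x}\in\{0,1\}^n:\mathbf{x}\cdot\mathbf{y}=0\ \forall\mathbf{y}\in\mathcal{C}(n)\}$. Secure nested code sequence: $\mathcal{C}_1(n)\subseteq\mathcal{C}_0(n)$ linear codes of rates $R_1\le R_0$; cosets of $\mathcal{C}_1(n)$ in $\mathcal{C}_0(n)$ are indexed by messages $w\in\{1,\dots,M\}$, $M=2^{n(R_0-R_1)}$; a uniform message $W=w$ is encoded by choosing a codeword uniformly at random from coset $\mathcal{C}_w(n)$;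 the legitimate receiver recovers $w$ as the coset of the received word. Information rate is $R_0-R_1$. A pair $(R,R_e)$ is achievable if there is a rate-$R$ code sequence with average error probability at the legitimate receiver tending to $0$ and $R_e\le\lim_{n\to\infty}H(W|\mathbf{Z})/n$, where $\mathbf{Z}$ is the eavesdropper's output. *)

(* Defs.v *)
From HB Require Import structures.
From mathcomp Require Import all_boot all_order all_algebra.
From mathcomp Require Import all_classical all_reals all_analysis.
Set Implicit Arguments. Unset Strict Implicit. Unset Printing Implicit Defensive.
Import Order.TTheory GRing.Theory Num.Theory numFieldNormedType.Exports.
Local Open Scope ring_scope.
Local Open Scope classical_set_scope.

Section Codes.
Variable n : nat.
Notation vec := 'rV['F_2]_n.

(* binary linear code: nonempty (contains 0) and closed under addition
   (over F_2 this is exactly an F_2-linear subspace) *)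
Definition is_linear_code (C : {set vec}) : Prop :=
  (0 : vec) \in C /\ forall x y, x \in C -> y \in C -> x + y \in C.

Definition dual_code (C : {set vec}) : {set vec} :=
  [set x : vec | [forall y in C, \sum_(i < n) x 0 i * y 0 i == 0]].

Definition coset_of (C1 : {set vec}) (x : vec) : {set vec} :=
  [set x + c | c in C1].
Definition cosets (C1 : {set vec}) : {set {set vec}} :=
  [set coset_of C1 x | x : vec].
Definition coset_t (C1 : {set vec}) : finType :=
  {A : {set vec} | A \in cosets C1}.

Lemma coset_of_in (C1 : {set vec}) (x : vec) : coset_of C1 x \in cosets C1.
Proof. exact: imset_f. Qed.

Variable R : realType.

Definition log2 (x : R) : R := ln x / ln 2.

Definition is_channel (Y : finType) (W : 'F_2 -> Y -> R) : Prop :=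
  forall x, (forall y, 0 <= W x y) /\ \sum_y W x y = 1.
Definition noisy (Y : finType) (W : 'F_2 -> Y -> R) : Prop :=
  exists y, 0 < W 0 y /\ 0 < W 1 y.

Definition chan_n (Y : finType) (W : 'F_2 -> Y -> R)
    (x : vec) (y : {ffun 'I_n -> Y}) : R :=
  \prod_(i < n) W (x 0 i) (y i).

Definition ml_dec (Y : finType) (W : 'F_2 -> Y -> R) (C : {set vec})
    (y : {ffun 'I_n -> Y}) : vec :=
  Order.arg_max (0 : vec) (fun c => c \in C) (fun c => chan_n W c y).

Definition ml_err (Y : finType) (W : 'F_2 -> Y -> R) (C : {set vec}) : R :=
  #|C|%:R^-1 * \sum_(c in C) \sum_(y : {ffun 'I_n -> Y})
      chan_n W c y * (ml_dec W C y != c)%:R.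

Definition bec (d : R) (x : 'F_2) (y : option 'F_2) : R :=
  match y with None => d | Some b => if b == x then 1 - d else 0 end.

Definition bsc_n (q : R) (x z : vec) : R :=
  \prod_(i < n) (if x 0 i == z 0 i then 1 - q else q).

(* Wiretap code with message type Mt (uniform messages), stochastic encoder
   enc w x = P(X = x | W = w), decoder dec at the legitimate receiver.
   Main channel noiseless: legitimate receiver observes X. *)
Definition wt_err_noiseless (Mt : finType) (enc : Mt -> vec -> R)
    (dec : vec -> Mt) : R :=
  #|Mt|%:R^-1 * \sum_(w : Mt) \sum_(x : vec) enc w x * (dec x != w)%:R.

Definition wt_equiv_bsc (q : R) (Mt : finType) (enc : Mt -> vec -> R) : R :=
  let PWZ w z := #|Mt|%:R^-1 * \sum_(x : vec) enc w x * bsc_n q x z in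
  let PZ z := \sum_(w : Mt) PWZ w z in
  - \sum_(w : Mt) \sum_(z : vec)
      (if PWZ w z == 0 then 0 else PWZ w z * log2 (PWZ w z / PZ z)).

Definition nested_enc (C1 : {set vec}) (w : coset_t C1) (x : vec) : R :=
  if x \in sval w then #|sval w|%:R^-1 else 0.
Definition nested_dec (C1 : {set vec}) (x : vec) : coset_t C1 :=
  exist _ (coset_of C1 x) (coset_of_in C1 x).

End Codes.

Definition lin_code_seq (R : realType) (N : nat -> nat)
    (C : forall m, {set 'rV['F_2]_(N m)}) (Rc : R) : Prop :=
  (forall m, (N m < N m.+1)%N) /\
  (forall m, is_linear_code (C m)) /\
  exists k : nat -> nat, forall m,
    #|C m| = (2 ^ k m)%N /\ (k m)%:R = Rc * (N m)%:R.

Definition good_code_seq (R : realType) (N : nat -> nat)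
    (C : forall m, {set 'rV['F_2]_(N m)}) (Rc : R) : Prop :=
  0 < Rc /\
  exists (Y : finType) (W : 'F_2 -> Y -> R),
    is_channel W /\ noisy W /\ (fun m => ml_err W (C m)) @ \oo --> (0 : R).

Definition erasure_threshold (R : realType) (N : nat -> nat)
    (C : forall m, {set 'rV['F_2]_(N m)}) : R :=
  sup [set d : R | 0 <= d <= 1 /\
       (fun m => ml_err (bec d) (C m)) @ \oo --> (0 : R)].

Definition wt_achieves (R : realType) (q : R) (N : nat -> nat)
    (Mt : nat -> finType) (enc : forall m, Mt m -> 'rV['F_2]_(N m) -> R)
    (dec : forall m, 'rV['F_2]_(N m) -> Mt m) (Rate Re : R) : Prop :=
  (forall m, (N m < N m.+1)%N) /\
  (forall m, log2 (#|Mt m|%:R : R) = Rate * (N m)%:R) /\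
  (fun m => wt_err_noiseless (enc m) (dec m)) @ \oo --> (0 : R) /\
  exists l : R,
    (fun m => wt_equiv_bsc q (enc m) / (N m)%:R) @ \oo --> l /\ Re <= l.

(* Main.v *)
(** The eavesdropper's uncertainty is the entropy of the coset of the channel
    output, i.e. of a syndrome of the BSC noise.  Write the noise as a mixture:
    each position lies in a random set [S] with probability [d], the noise bit
    having bias [s] on [S] and bias [t] off [S], where
    [d * s + (1 - d) * t = 1 - 2 * q].  By Poisson summation over [C], if [S]
    contains the support of no nonzero codeword then every coset of the dual has
    conditional probability at most [(1 + t) ^ (n - #|S|) / #|C|]; averaging over
    such [S] gives at most [(1 + (1 - d) * t) ^ n / #|C|].  An [S] that does
    contain the support of a nonzero codeword makes any decoder for the erasure
    channel of parameter [d] fail with probability at least 1/2, so these [S] have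
    total mass at most twice the error probability.  Taking [d] just below the
    threshold makes [(1 - d) * t] small, whence the entropy is nearly
    [ln #|C|].  If [1 - 2 * q <= d], one takes [t = 0]; otherwise [s = 1]. *)
Require Import Defs.
From HB Require Import structures.
From mathcomp Require Import all_boot all_order all_algebra.
From mathcomp Require Import all_classical all_reals all_analysis.
From mathcomp Require Import ring lra.
Set Implicit Arguments.
Unset Strict Implicit.
Unset Printing Implicit Defensive.
Import Order.TTheory GRing.Theory Num.Theory numFieldNormedType.Exports.
Local Open Scope ring_scope.

(** * Characters of F_2 and the inner product *)

(** The nontrivial real character of the additive group of F_2. *)
Definition chi (R : realType) (b : 'F_2) : R := if b == 0 then 1 else -1.

Definition dot (n : nat) (x y : 'rV['F_2]_n) : 'F_2 := \sum_(i < n) x 0 i * y 0 i.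

Lemma F2_eq01 (b : 'F_2) : b = 0 \/ b = 1.
Proof.
by case: b => [[|[|b]] hb]; [left|right|]; rewrite //; apply/val_inj.
Qed.

Lemma add_F2_self (b : 'F_2) : b + b = 0.
Proof. by case: (F2_eq01 b) => ->; apply/val_inj. Qed.

Lemma addv_self (n : nat) (x : 'rV['F_2]_n) : x + x = 0.
Proof. by apply/rowP => i; rewrite !mxE add_F2_self. Qed.

Lemma oppv_self (n : nat) (x : 'rV['F_2]_n) : - x = x.
Proof. by apply/eqP; rewrite eq_sym -addr_eq0 addv_self. Qed.

Lemma sum_F2 (R : realType) (F : 'F_2 -> R) : \sum_b F b = F 0 + F 1.
Proof.
rewrite big_ord_recl big_ord_recl big_ord0 addr0.
by congr (F _ + F _); apply/val_inj.
Qed.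

Lemma chi0 (R : realType) : chi R 0 = 1.
Proof. by rewrite /chi eqxx. Qed.

Lemma chiD (R : realType) (a b : 'F_2) : chi R (a + b) = chi R a * chi R b.
Proof.
rewrite /chi; case: (F2_eq01 a) => ->; case: (F2_eq01 b) => ->.
- by rewrite addr0 eqxx mulr1.
- by rewrite add0r eqxx mul1r.
- by rewrite addr0 eqxx mulr1.
- by rewrite add_F2_self eqxx oner_eq0 mulrNN mulr1.
Qed.

Lemma chi_sum (R : realType) (n : nat) (F : 'I_n -> 'F_2) :
  chi R (\sum_i F i) = \prod_i chi R (F i).
Proof. by apply: (big_morph (chi R) (@chiD R) (chi0 R)). Qed.

Lemma normr_chi (R : realType) (b : 'F_2) : `|chi R b| = 1.
Proof. by rewrite /chi; case: ifP; rewrite ?normrN normr1. Qed.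

Lemma sum_row_prod (R : realType) (n : nat) (F : 'I_n -> 'F_2 -> R) :
  \sum_(x : 'rV['F_2]_n) \prod_i F i (x 0 i) = \prod_i (F i 0 + F i 1).
Proof.
transitivity (\prod_(i < n) \sum_(b : 'F_2) F i b); last first.
  by apply: eq_bigr => i _; rewrite sum_F2.
rewrite bigA_distr_bigA.
rewrite (reindex (fun f : {ffun 'I_n -> 'F_2} => \row_i f i)) /=.
  by apply: eq_bigr => f _; apply: eq_bigr => i _; rewrite mxE.
exists (fun x : 'rV['F_2]_n => [ffun i => x 0 i]) => x _.
  by apply/ffunP => i; rewrite ffunE mxE.
by apply/rowP => i; rewrite mxE ffunE.
Qed.

Lemma dotC (n : nat) (x y : 'rV['F_2]_n) : dot x y = dot y x.
Proof. by apply: eq_bigr => i _; rewrite mulrC. Qed.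

Lemma dotDl (n : nat) (x y z : 'rV['F_2]_n) : dot (x + y) z = dot x z + dot y z.
Proof. by rewrite -big_split; apply: eq_bigr => i _; rewrite mxE mulrDl. Qed.

Lemma dotDr (n : nat) (x y z : 'rV['F_2]_n) : dot z (x + y) = dot z x + dot z y.
Proof. by rewrite dotC dotDl !(dotC z). Qed.

(** * Duality and Poisson summation *)

Lemma mem_dual (n : nat) (C : {set 'rV['F_2]_n}) (x : 'rV['F_2]_n) :
  reflect (forall y, y \in C -> dot x y = 0) (x \in dual_code C).
Proof.
rewrite inE; apply: (iffP forall_inP) => h y yC; first exact/eqP/h.
by apply/eqP/h.
Qed.

Lemma dual_linear (n : nat) (C : {set 'rV['F_2]_n}) : is_linear_code (dual_code C).
Proof.
split; first by apply/mem_dual => y _; rewrite /dot big1 // => i _; rewrite mxE mul0r.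
move=> x y /mem_dual hx /mem_dual hy; apply/mem_dual => z zC.
by rewrite dotDl hx // hy // addr0.
Qed.

(** Orthogonality of characters: if [x] is outside the dual, some codeword [u] has [dot x u = 1],
    and translating the sum by [u] flips its sign. *)
Lemma sum_chi_dual (R : realType) (n : nat) (C : {set 'rV['F_2]_n})
    (x : 'rV['F_2]_n) : is_linear_code C ->
  \sum_(c in C) chi R (dot x c) = #|C|%:R * (x \in dual_code C)%:R.
Proof.
case=> C0 CD; case: (boolP (x \in dual_code C)) => [/mem_dual h|h].
  rewrite mulr1 (eq_bigr (fun=> 1)) ?sumr_const // => c cC.
  by rewrite h // chi0.
have [u uC hu] : exists2 u, u \in C & dot x u = 1.
  move: h; rewrite inE negb_forall => /existsP[u]; rewrite negb_imply => /andP[uC].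
  move=> hu; exists u => //; case: (F2_eq01 (dot x u)) => // h0.
  by move: hu; rewrite -/(dot x u) h0 eqxx.
have uK : involutive (fun c : 'rV['F_2]_n => c + u).
  by move=> c; rewrite -addrA addv_self addr0.
have uC' c : (c + u \in C) = (c \in C).
  by apply/idP/idP => h'; [rewrite -(uK c)|]; apply: CD.
rewrite mulr0; set s := LHS.
suff : s = - s by move/eqP; rewrite -addr_eq0 -mulr2n mulrn_eq0 /= => /eqP.
rewrite {1}/s (reindex_inj (inv_inj uK)) /= (eq_bigl _ _ uC') /s -sumrN.
by apply: eq_bigr => c _; rewrite dotDr chiD hu /chi oner_eq0 mulrN1.
Qed.

(** Double counting of the character sum over pairs of a word and a codeword: summed over words
    first, only the codeword 0 survives. *)
Lemma card_dual (R : realType) (n : nat) (C : {set 'rV['F_2]_n}) :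
  is_linear_code C -> #|C|%:R * #|dual_code C|%:R = 2 ^+ n :> R.
Proof.
move=> linC; have [C0 _] := linC.
transitivity (\sum_(x : 'rV['F_2]_n) \sum_(c in C) chi R (dot x c)).
  rewrite (eq_bigr _ (fun x _ => sum_chi_dual R x linC)) -mulr_sumr.
  congr (_ * _); rewrite -sum1_card natr_sum big_mkcond.
  by apply: eq_bigr => x _; case: (x \in _).
rewrite exchange_big (bigD1 0) //= [X in _ + X]big1 => [|c /andP[_ c0]].
  rewrite addr0 (eq_bigr (fun=> 1)) => [|x _].
    by rewrite sumr_const card_mx card_Fp // mul1n natrX.
  by rewrite /dot big1 ?chi0 // => i _; rewrite mxE mulr0.
under eq_bigr do rewrite chi_sum.
rewrite (sum_row_prod (fun i b => chi R (b * c 0 i))).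
have [i ci] : exists i, c 0 i != 0.
  apply/existsP; apply: contraR c0; rewrite negb_exists => /forallP h.
  by apply/eqP/rowP => i; rewrite mxE; apply/eqP; rewrite -[_ == _]negbK.
apply/eqP; rewrite prodf_seq_eq0; apply/hasP; exists i; first exact: mem_index_enum.
by rewrite /= mul0r mul1r chi0 /chi (negbTE ci) subrr.
Qed.

Lemma mem_coset (n : nat) (D : {set 'rV['F_2]_n}) (v x : 'rV['F_2]_n) :
  (x \in coset_of D v) = (x + v \in D).
Proof.
apply/imsetP/idP => [[c cD ->]|h]; first by rewrite addrC addrA addv_self add0r.
by exists (x + v) => //; rewrite addrCA addv_self addr0.
Qed.

(** Poisson summation: the indicator of the coset is a character sum over [C], and exchanging the
    sums leaves the Fourier transform of a product function, which factors by position. *)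
Lemma sum_coset (R : realType) (n : nat) (C : {set 'rV['F_2]_n})
    (v : 'rV['F_2]_n) (F : 'I_n -> 'F_2 -> R) : is_linear_code C ->
  #|C|%:R * \sum_(x in coset_of (dual_code C) v) \prod_i F i (x 0 i) =
  \sum_(c in C) chi R (dot v c) * \prod_i (F i 0 + chi R (c 0 i) * F i 1).
Proof.
move=> linC.
transitivity (\sum_(x : 'rV['F_2]_n) \sum_(c in C)
    chi R (dot (x + v) c) * \prod_i F i (x 0 i)).
  rewrite big_mkcond mulr_sumr; apply: eq_bigr => x _.
  rewrite -mulr_suml sum_chi_dual // mem_coset.
  by case: ifP; rewrite ?mulr1 ?mulr0 ?mul0r.
rewrite exchange_big; apply: eq_bigr => c _.
transitivity (chi R (dot v c) * \sum_(x : 'rV['F_2]_n)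
    \prod_i (chi R (x 0 i * c 0 i) * F i (x 0 i))).
  rewrite mulr_sumr; apply: eq_bigr => x _.
  by rewrite dotDl chiD mulrAC mulrC big_split /= -chi_sum.
rewrite (@sum_row_prod R n (fun i b => chi R (b * c 0 i) * F i b)).
by congr (_ * _); apply: eq_bigr => i _; rewrite mul0r chi0 !mul1r.
Qed.

(** * Position sets covering no nonzero codeword *)

(* No nonzero codeword of [C] is supported in [S]. *)
Definition uncovered (n : nat) (C : {set 'rV['F_2]_n}) (S : {set 'I_n}) : bool :=
  [forall c in C, [forall i, (i \notin S) ==> (c 0 i == 0)] ==> (c == 0)].

(** Setting the coordinates in [S] to 0 is injective on [C], so the left side is a subsum of the
    weights of all words vanishing on [S]. *)
Lemma sum_code_weight (R : realType) (n : nat) (C : {set 'rV['F_2]_n})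
    (S : {set 'I_n}) (t : R) : is_linear_code C -> uncovered C S -> 0 <= t ->
  \sum_(c in C) \prod_i (if i \in S then 1 else if c 0 i == 0 then 1 else t)
  <= \prod_i (if i \in S then 1 else 1 + t).
Proof.
move=> [C0 CD] /forall_inP good t0.
pose mask (c : 'rV['F_2]_n) : 'rV['F_2]_n := \row_i (if i \in S then 0 else c 0 i).
have mask_inj : {in C &, injective mask}.
  move=> c c' cC c'C /rowP h.
  have := good (c + c') (CD _ _ cC c'C); move/implyP => h'.
  suff /h' : [forall i, (i \notin S) ==> ((c + c') 0 i == 0)].
    by rewrite addr_eq0 oppv_self => /eqP.
  apply/forallP => i; apply/implyP => iS; move: (h i).
  by rewrite !mxE (negbTE iS) => ->; rewrite add_F2_self.
(* [H] gives weight 0 to words that are nonzero somewhere on [S]. *)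
pose H i (b : 'F_2) : R :=
  if i \in S then (b == 0)%:R else if b == 0 then 1 else t.
have H0 i b : 0 <= H i b by rewrite /H; case: ifP => _ //; case: ifP.
have -> : \prod_i (if i \in S then 1 else 1 + t) =
    \sum_(x : 'rV['F_2]_n) \prod_i H i (x 0 i).
  rewrite sum_row_prod; apply: eq_bigr => i _.
  by rewrite /H eqxx oner_eq0; case: ifP; rewrite ?addr0.
rewrite (eq_bigr (fun c => \prod_i H i (mask c 0 i))); last first.
  move=> c _; apply: eq_bigr => i _; rewrite /H mxE.
  by case: ifP => //; rewrite eqxx.
rewrite -(big_imset (fun y : 'rV['F_2]_n => \prod_i H i (y 0 i)) mask_inj) /=.
rewrite [leRHS](bigID (mem (mask @: C)%SET)) /= lerDl.
by apply: sumr_ge0 => y _; apply: prodr_ge0.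
Qed.

(** * Binary symmetric noise as a mixture *)

(** Binary symmetric channel with crossover probability [(1 - s) / 2]; [s] is the bias of the noise
    bit. *)
Definition bit_prob (R : realType) (s : R) (x z : 'F_2) : R :=
  if x == z then (1 + s) / 2 else (1 - s) / 2.

Lemma bit_prob_ge0 (R : realType) (s : R) (x z : 'F_2) :
  `|s| <= 1 -> 0 <= bit_prob s x z.
Proof. by rewrite ler_norml /bit_prob => /andP[h1 h2]; case: ifP => _; lra. Qed.

Lemma bit_prob_fourier (R : realType) (s : R) (z c : 'F_2) :
  `|bit_prob s 0 z + chi R c * bit_prob s 1 z| = if c == 0 then 1 else `|s|.
Proof.
rewrite /bit_prob /chi; case: (F2_eq01 z) => ->; case: (F2_eq01 c) => ->;
  rewrite ?eqxx ?oner_eq0 1?eq_sym ?oner_eq0 /= ?mulN1r ?mul1r.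
- by rewrite -[RHS]normr1; congr (`| _ |); field.
- by congr (`| _ |); field.
- by rewrite -[RHS]normr1; congr (`| _ |); field.
- by rewrite -[RHS]normrN; congr (`| _ |); field.
Qed.

(** Law of the erasure pattern of [bec d]: positions lie in [S] independently with probability
    [d]. *)
Definition pattern_prob (R : realType) (n : nat) (d : R) (S : {set 'I_n}) : R :=
  \prod_i (if i \in S then d else 1 - d).

Lemma pattern_prob_ge0 (R : realType) (n : nat) (d : R) (S : {set 'I_n}) :
  0 <= d <= 1 -> 0 <= pattern_prob d S.
Proof.
move=> /andP[d0 d1]; apply: prodr_ge0 => i _.
by case: ifP => _ //; rewrite subr_ge0.
Qed.

Definition noise_given (R : realType) (n : nat) (s t : R) (S : {set 'I_n})
    (x z : 'rV['F_2]_n) : R :=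
  \prod_i bit_prob (if i \in S then s else t) (x 0 i) (z 0 i).

Lemma noise_given_ge0 (R : realType) (n : nat) (s t : R) (S : {set 'I_n})
    (x z : 'rV['F_2]_n) : `|s| <= 1 -> `|t| <= 1 -> 0 <= noise_given s t S x z.
Proof.
by move=> hs ht; apply: prodr_ge0 => i _; apply: bit_prob_ge0; case: ifP.
Qed.

Lemma sum_noise_given (R : realType) (n : nat) (s t : R) (S : {set 'I_n})
    (z : 'rV['F_2]_n) : \sum_x noise_given s t S x z = 1.
Proof.
rewrite (sum_row_prod
  (fun i b => bit_prob (if i \in S then s else t) b (z 0 i))).
apply: big1 => i _; rewrite /bit_prob.
by case: (F2_eq01 (z 0 i)) => ->; rewrite ?eqxx ?oner_eq0 1?eq_sym ?oner_eq0; field.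
Qed.

Lemma bsc_mixture (R : realType) (n : nat) (q d s t : R) (x z : 'rV['F_2]_n) :
  d * s + (1 - d) * t = 1 - 2 * q ->
  bsc_n q x z = \sum_(S : {set 'I_n}) pattern_prob d S * noise_given s t S x z.
Proof.
move=> e.
transitivity (\prod_(i < n) (d * bit_prob s (x 0 i) (z 0 i) +
    (1 - d) * bit_prob t (x 0 i) (z 0 i))).
  by apply: eq_bigr => i _; rewrite /bit_prob; case: ifP => _; lra.
rewrite bigA_distr; apply: eq_bigr => S _; rewrite -big_split.
by apply: eq_bigr => i _ /=; case: ifP.
Qed.

(** After Poisson summation, terms are bounded by absolute values: factors on [S] are at most 1 and
    those off [S] are 1 or [t], so [sum_code_weight] applies. *)
Lemma coset_given_le (R : realType) (n : nat) (C : {set 'rV['F_2]_n})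
    (S : {set 'I_n}) (s t : R) (v z : 'rV['F_2]_n) :
  is_linear_code C -> uncovered C S -> `|s| <= 1 -> 0 <= t ->
  #|C|%:R * \sum_(x in coset_of (dual_code C) v) noise_given s t S x z
  <= \prod_i (if i \in S then 1 else 1 + t).
Proof.
move=> linC good hs t0.
rewrite (@sum_coset R n C v
  (fun i b => bit_prob (if i \in S then s else t) b (z 0 i))) //.
apply: le_trans (ler_norm _) _; apply: le_trans (ler_norm_sum _ _ _) _.
apply: le_trans (sum_code_weight linC good t0); apply: ler_sum => c _.
rewrite normrM normr_chi mul1r normr_prod; apply: ler_prod => i _.
rewrite normr_ge0 bit_prob_fourier.
by case: (i \in S); case: (c 0 i == 0) => /=; rewrite ?lexx // ger0_norm ?lexx.
Qed.

(* Averaging over [S] matters: [t] itself may be large when [d] is close to 1,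
   only [(1 - d) * t] is controlled. *)
Lemma sum_pattern_prob_growth (R : realType) (n : nat) (d t : R) :
  \sum_(S : {set 'I_n}) pattern_prob d S * \prod_i (if i \in S then 1 else 1 + t)
  = (1 + (1 - d) * t) ^+ n.
Proof.
transitivity (\prod_(i < n) (d + (1 - d) * (1 + t))); last first.
  by rewrite prodr_const card_ord; congr (_ ^+ _); ring.
rewrite bigA_distr; apply: eq_bigr => S _; rewrite -big_split.
by apply: eq_bigr => i _ /=; case: ifP; rewrite ?mulr1.
Qed.

(** * Splitting coset probabilities by noise pattern *)

Definition cover_prob (R : realType) (n : nat) (C : {set 'rV['F_2]_n}) (d : R) : R :=
  \sum_(S : {set 'I_n} | ~~ uncovered C S) pattern_prob d S.

(** Share of the noncovering patterns in the posterior probability of a coset [A] given the output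
    [z]. *)
Definition good_part (R : realType) (n : nat) (C : {set 'rV['F_2]_n}) (d s t : R)
    (A : {set 'rV['F_2]_n}) (z : 'rV['F_2]_n) : R :=
  \sum_(S : {set 'I_n} | uncovered C S)
    pattern_prob d S * \sum_(x in A) noise_given s t S x z.

Definition bad_part (R : realType) (n : nat) (C : {set 'rV['F_2]_n}) (d s t : R)
    (A : {set 'rV['F_2]_n}) (z : 'rV['F_2]_n) : R :=
  \sum_(S : {set 'I_n} | ~~ uncovered C S)
    pattern_prob d S * \sum_(x in A) noise_given s t S x z.

Lemma good_bad_split (R : realType) (n : nat) (C : {set 'rV['F_2]_n}) (q d s t : R)
    (A : {set 'rV['F_2]_n}) (z : 'rV['F_2]_n) :
  d * s + (1 - d) * t = 1 - 2 * q ->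
  \sum_(x in A) bsc_n q x z = good_part C d s t A z + bad_part C d s t A z.
Proof.
move=> e; rewrite (eq_bigr _ (fun x _ => bsc_mixture x z e)) exchange_big /=.
rewrite (bigID (uncovered C)) /=.
by congr (_ + _); apply: eq_bigr => S _; rewrite mulr_sumr.
Qed.

(** Averages [coset_given_le] over noncovering sets; adding the nonnegative terms of the other sets
    completes the sum to a closed form. *)
Lemma good_part_le (R : realType) (n : nat) (C : {set 'rV['F_2]_n}) (d s t : R)
    (v z : 'rV['F_2]_n) :
  is_linear_code C -> 0 <= d <= 1 -> `|s| <= 1 -> 0 <= t ->
  good_part C d s t (coset_of (dual_code C) v) z
  <= (1 + (1 - d) * t) ^+ n / #|C|%:R.
Proof.
move=> linC d01 hs t0.
have C_gt0 : 0 < #|C|%:R :> R.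
  by rewrite ltr0n card_gt0; apply/set0Pn; exists 0; case: linC.
rewrite ler_pdivlMr // mulrC mulr_sumr -sum_pattern_prob_growth.
rewrite [leRHS](bigID (uncovered C)) /= -[leLHS]addr0; apply: lerD.
  apply: ler_sum => S good; rewrite mulrCA ler_wpM2l ?pattern_prob_ge0 //.
  exact: coset_given_le.
apply: sumr_ge0 => S _; rewrite mulr_ge0 ?pattern_prob_ge0 //.
by apply: prodr_ge0 => i _; case: ifP => _ //; rewrite addr_ge0.
Qed.

(** * Covering patterns and erasure decoding *)

Definition erase (n : nat) (S : {set 'I_n}) (c : 'rV['F_2]_n) :
    {ffun 'I_n -> option 'F_2} :=
  [ffun i => if i \in S then None else Some (c 0 i)].

Lemma erase_inj (n : nat) (c : 'rV['F_2]_n) :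
  injective (fun S : {set 'I_n} => erase S c).
Proof.
move=> S S' /ffunP h; apply/setP => i; move: (h i); rewrite !ffunE.
by case: (i \in S); case: (i \in S').
Qed.

Lemma chan_n_erase (R : realType) (n : nat) (d : R) (S : {set 'I_n})
    (c : 'rV['F_2]_n) : chan_n (bec d) c (erase S c) = pattern_prob d S.
Proof.
apply: eq_bigr => i _; rewrite ffunE; case: (i \in S) => //=.
by rewrite eqxx.
Qed.

Lemma chan_n_bec_ge0 (R : realType) (n : nat) (d : R) (c : 'rV['F_2]_n)
    (y : {ffun 'I_n -> option 'F_2}) : 0 <= d <= 1 -> 0 <= chan_n (bec d) c y.
Proof.
move=> /andP[d0 d1]; apply: prodr_ge0 => i _; rewrite /bec.
by case: (y i) => [b|] //; case: ifP => // _; rewrite subr_ge0.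
Qed.

Lemma coverP (n : nat) (C : {set 'rV['F_2]_n}) (S : {set 'I_n}) :
  ~~ uncovered C S ->
  exists u : 'rV['F_2]_n, [/\ u \in C, u != 0 & forall i, i \notin S -> u 0 i = 0].
Proof.
rewrite negb_forall => /existsP[u]; rewrite !negb_imply => /and3P[uC h u0].
exists u; split=> // i iS; apply/eqP.
by move/forallP/(_ i)/implyP: h; apply.
Qed.

(* If S covers a nonzero codeword u, then c and c + u look the same once S is
   erased, so any decoder is wrong on at least one of the two. *)
Lemma cover_decoder_error (R : realType) (n : nat) (C : {set 'rV['F_2]_n})
    (S : {set 'I_n}) (dec : {ffun 'I_n -> option 'F_2} -> 'rV['F_2]_n) :
  is_linear_code C -> ~~ uncovered C S ->
  #|C|%:R <= 2 * \sum_(c in C) (dec (erase S c) != c)%:R :> R.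
Proof.
move=> [C0 CD] /coverP[u [uC u0 hu]].
have uK : involutive (fun c : 'rV['F_2]_n => c + u).
  by move=> c; rewrite -addrA addv_self addr0.
have uC' c : (c + u \in C) = (c \in C).
  by apply/idP/idP => h'; [rewrite -(uK c)|]; apply: CD.
have erase_u c : erase S (c + u) = erase S c.
  apply/ffunP => i; rewrite !ffunE; case: ifP => // /negbT iS.
  by rewrite mxE hu // addr0.
(* One of the two copies of the sum is shifted by [u], so that errors at [c] and [c + u] are counted
   together. *)
rewrite mulr_natl mulr2n {2}(reindex_inj (inv_inj uK)) /= (eq_bigl _ _ uC').
rewrite -big_split -sum1_card natr_sum /=; apply: ler_sum => c _.
rewrite erase_u -natrD ler_nat.
have [->|//] := eqVneq (dec (erase S c)) c.
rewrite add0n; suff -> : c != c + u by [].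
by apply: contra u0 => /eqP h; rewrite -(inj_eq (addrI c)) addr0 -h.
Qed.

(** For fixed [c], distinct patterns give distinct outputs [erase S c], so the sum over patterns is
    at most the sum over all outputs. *)
Lemma cover_prob_le (R : realType) (n : nat) (C : {set 'rV['F_2]_n}) (d : R) :
  is_linear_code C -> 0 <= d <= 1 -> cover_prob C d <= 2 * ml_err (bec d) C.
Proof.
move=> linC d01.
have C_gt0 : 0 < #|C|%:R :> R.
  by rewrite ltr0n card_gt0; apply/set0Pn; exists 0; case: linC.
rewrite /ml_err mulrCA mulrC ler_pdivlMr // mulrC.
pose dec := ml_dec (bec d) C.
apply: (@le_trans _ _ (2 * \sum_(c in C) \sum_(S : {set 'I_n})
    pattern_prob d S * (dec (erase S c) != c)%:R)).
  rewrite exchange_big /= /cover_prob !mulr_sumr.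
  rewrite [leRHS](bigID (uncovered C)) /= -[leLHS]add0r; apply: lerD.
    apply: sumr_ge0 => S _; rewrite mulr_ge0 //; apply: sumr_ge0 => c _.
    by rewrite mulr_ge0 ?pattern_prob_ge0.
  apply: ler_sum => S bad; rewrite -mulr_sumr mulrCA mulrC.
  by rewrite ler_wpM2l ?pattern_prob_ge0 //; apply: cover_decoder_error.
rewrite ler_wpM2l //; apply: ler_sum => c _.
rewrite (eq_bigr (fun S => chan_n (bec d) c (erase S c) *
    (dec (erase S c) != c)%:R)); last by move=> S _; rewrite chan_n_erase.
have inj_c : {in [set: {set 'I_n}] &, injective (fun S => erase S c)}.
  by move=> S S' _ _; apply: erase_inj.
pose G y := chan_n (bec d) c y * (dec y != c)%:R.
have G0 y : 0 <= G y by rewrite mulr_ge0 ?chan_n_bec_ge0.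
rewrite [leLHS](_ : _ = \sum_(y in [set erase S c | S in [set: {set 'I_n}]]) G y).
  rewrite [leRHS](bigID (mem [set erase S c | S in [set: {set 'I_n}]])) /= lerDl.
  by apply: sumr_ge0 => y _; apply: G0.
by rewrite (big_imset G inj_c); apply: eq_bigl => S; rewrite inE.
Qed.

(** * Cosets as messages *)

Lemma mem_coset_t (n : nat) (D : {set 'rV['F_2]_n}) (w : coset_t D)
    (x : 'rV['F_2]_n) : is_linear_code D ->
  (x \in sval w) = (nested_dec D x == w).
Proof.
move=> [D0 DD]; case: w => A hA; rewrite -(inj_eq val_inj) /=.
have /imsetP[v _ ->] := hA; rewrite mem_coset; apply/idP/eqP => [xv|eq_x].
  apply/setP => y; rewrite !mem_coset; apply/idP/idP => h.
    have := DD _ _ h xv.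
    by rewrite addrA -(addrA y) addv_self addr0.
  have := DD _ _ h xv.
  by rewrite (addrC x) addrA -(addrA y) addv_self addr0.
by rewrite -mem_coset -eq_x; apply/imsetP; exists 0; rewrite ?addr0.
Qed.

Lemma card_coset (n : nat) (D : {set 'rV['F_2]_n}) (w : coset_t D) :
  #|sval w| = #|D|.
Proof.
case: w => A hA /=; have /imsetP[v _ ->] := hA.
by rewrite card_imset //; apply: addrI.
Qed.

Lemma sum_coset_t (R : realType) (n : nat) (D : {set 'rV['F_2]_n})
    (F : 'rV['F_2]_n -> R) : is_linear_code D ->
  \sum_(w : coset_t D) \sum_(x in sval w) F x = \sum_x F x.
Proof.
move=> linD; rewrite [RHS](partition_big (nested_dec D) predT) //=.
by apply: eq_bigr => w _; apply: eq_bigl => x; rewrite mem_coset_t.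
Qed.

Lemma card_coset_t (R : realType) (n : nat) (D : {set 'rV['F_2]_n}) :
  is_linear_code D -> #|{: coset_t D}|%:R * #|D|%:R = 2 ^+ n :> R.
Proof.
move=> linD; transitivity (\sum_(x : 'rV['F_2]_n) (1 : R)).
  rewrite -(sum_coset_t _ linD) mulr_natl -sumr_const.
  by apply: eq_bigr => w _; rewrite sumr_const card_coset.
by rewrite sumr_const card_mx card_Fp // mul1n natrX.
Qed.

(** Both numbers times the size of the dual give [2 ^+ n]; hence the message rate is the rate of
    [C]. *)
Lemma card_coset_t_dual (R : realType) (n : nat) (C : {set 'rV['F_2]_n}) :
  is_linear_code C -> #|{: coset_t (dual_code C)}|%:R = #|C|%:R :> R.
Proof.
move=> linC; have [D0 _] := dual_linear C.
have D_neq0 : #|dual_code C|%:R != 0 :> R.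
  by rewrite pnatr_eq0 cards_eq0; apply/set0Pn; exists 0.
apply: (mulIf D_neq0).
by rewrite card_coset_t ?card_dual //; apply: dual_linear.
Qed.

Lemma sum_bsc_n (R : realType) (n : nat) (q : R) (z : 'rV['F_2]_n) :
  \sum_x bsc_n q x z = 1.
Proof.
rewrite (sum_row_prod (fun i b => if b == z 0 i then 1 - q else q)).
apply: big1 => i _.
by case: (F2_eq01 (z 0 i)) => ->; rewrite ?eqxx ?oner_eq0 1?eq_sym ?oner_eq0; ring.
Qed.

(** * Entropy bounds *)

(* In nats; the term of a [w] with [p w = 0] vanishes since [ln 0 = 0]. *)
Definition shannon (R : realType) (T : finType) (p : T -> R) : R :=
  \sum_w - (p w * ln (p w)).

Lemma ln_le_sub1 (R : realType) (x : R) : 0 < x -> ln x <= x - 1.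
Proof.
move=> x0; have {1}-> : x = 1 + (x - 1) by ring.
by apply: le_ln1Dx; lra.
Qed.

(** Gibbs' inequality against the uniform law, from [ln_le_sub1] at [(p w * #|T|)^-1]. *)
Lemma shannon_le (R : realType) (T : finType) (p : T -> R) :
  (forall w, 0 <= p w) -> \sum_w p w = 1 -> shannon p <= ln #|T|%:R.
Proof.
move=> p0 p1.
have M0 : 0 < #|T|%:R :> R.
  rewrite ltr0n lt0n; apply/eqP => T0; move: p1; rewrite big_pred0 => [|w].
    by move/esym/eqP; rewrite oner_eq0.
  by have := fintype0 w T0.
apply: (@le_trans _ _ (\sum_w (p w * ln #|T|%:R + (#|T|%:R^-1 - p w)))); last first.
  rewrite big_split sumrB /= -mulr_suml p1 mul1r sumr_const -[X in X - 1]mulr_natl.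
  by rewrite divff ?gt_eqF // subrr addr0.
apply: ler_sum => w _; have [->|pw] := eqVneq (p w) 0.
  by rewrite !mul0r oppr0 add0r addr0 invr_ge0 ltW.
have {}pw : 0 < p w by rewrite lt_neqAle eq_sym pw p0.
have V0 : 0 < (p w * #|T|%:R)^-1 by rewrite invr_gt0 mulr_gt0.
have := ln_le_sub1 V0; rewrite lnV ?posrE ?mulr_gt0 // lnM ?posrE //.
move/(ler_wpM2l (ltW pw)); rewrite invfM mulrBr mulrA mulfV ?gt_eqF // mul1r mulr1.
by rewrite mulrN mulrDr; lra.
Qed.

(** With [p = g + b <= 1], [- p * ln p] is at least [- g * ln p]; then [ln (p / u) <= p / u - 1] and
    [g <= u] give [g * ln p <= g * ln u + b]. *)
Lemma shannon_ge (R : realType) (T : finType) (g b : T -> R) (u : R) :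
  (forall w, 0 <= g w) -> (forall w, 0 <= b w) -> \sum_w (g w + b w) = 1 ->
  0 < u -> (forall w, g w <= u) ->
  - (1 - \sum_w b w) * ln u - \sum_w b w <= shannon (fun w => g w + b w).
Proof.
move=> g0 b0 p1 u0 gu.
have gE : 1 - \sum_w b w = \sum_w g w by rewrite -p1 big_split /= addrK.
rewrite gE mulNr mulr_suml -opprD -big_split -sumrN /=.
apply: ler_sum => w _; have p0 := addr_ge0 (g0 w) (b0 w).
have ple1 : g w + b w <= 1.
  by rewrite -p1 (bigD1 w) //= lerDl; apply: sumr_ge0 => v _; apply: addr_ge0.
have [pE|pn0] := eqVneq (g w + b w) 0.
  have gw0 : g w = 0 by have := g0 w; have := b0 w; lra.
  by rewrite pE mul0r gw0 mul0r add0r lerN2.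
have {}p0 : 0 < g w + b w by rewrite lt_neqAle eq_sym pn0.
have q0 : 0 < (g w + b w) / u by rewrite divr_gt0.
have bln : 0 <= - (b w * ln (g w + b w)) by rewrite -mulrN mulr_ge0 // oppr_ge0 ln_le0.
have := ln_le_sub1 q0; rewrite ln_div ?posrE // => /(ler_wpM2l (g0 w)).
have gb : g w * ((g w + b w) / u - 1) <= b w.
  have -> : g w * ((g w + b w) / u - 1) = (g w * b w + g w * (g w - u)) / u.
    by field; rewrite gt_eqF.
  rewrite ler_pdivrMr //.
  have := ler_wpM2r (b0 w) (gu w).
  have : g w * (g w - u) <= 0 by rewrite mulr_ge0_le0 // subr_le0.
  by move=> h1 h2; rewrite (mulrC (b w)); lra.
by move=> h; lra.
Qed.

(** * Equivocation of the nested code *)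

Lemma sum_bad_part (R : realType) (n : nat) (C D : {set 'rV['F_2]_n}) (d s t : R)
    (z : 'rV['F_2]_n) : is_linear_code D ->
  \sum_(w : coset_t D) bad_part C d s t (sval w) z = cover_prob C d.
Proof.
move=> linD; rewrite exchange_big; apply: eq_bigr => S _ /=.
by rewrite -mulr_sumr (sum_coset_t _ linD) sum_noise_given mulr1.
Qed.

Lemma bsc_n_ge0 (R : realType) (n : nat) (q : R) (x z : 'rV['F_2]_n) :
  0 <= q <= 1 -> 0 <= bsc_n q x z.
Proof.
move=> /andP[q0 q1]; apply: prodr_ge0 => i _.
by case: ifP => // _; rewrite subr_ge0.
Qed.

(** A uniform message and a uniform word of its coset make the input uniform, so the output is
    uniform too and the posterior of [w] given [z] is the [bsc_n] mass of the coset. Dividing by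
    [ln 2] turns nats into bits. *)
Lemma wt_equiv_nested (R : realType) (n : nat) (D : {set 'rV['F_2]_n}) (q : R) :
  is_linear_code D ->
  wt_equiv_bsc q (@nested_enc n R D) =
  (2 ^+ n)^-1 * (\sum_(z : 'rV['F_2]_n)
    shannon (fun w : coset_t D => \sum_(x in sval w) bsc_n q x z)) / ln 2.
Proof.
move=> linD; have u0 : (2 ^+ n)^-1 != 0 :> R by rewrite invr_eq0 expf_neq0 // pnatr_eq0.
have PE (w : coset_t D) z :
    #|{: coset_t D}|%:R^-1 * \sum_x nested_enc R w x * bsc_n q x z =
    (2 ^+ n)^-1 * \sum_(x in sval w) bsc_n q x z.
  rewrite -(card_coset_t R linD) invfM -mulrA; congr (_ * _).
  rewrite mulr_sumr [RHS]big_mkcond; apply: eq_bigr => x _.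
  by rewrite /nested_enc; case: ifP; rewrite ?mul0r // card_coset.
have PZ z : \sum_(w : coset_t D)
    #|{: coset_t D}|%:R^-1 * \sum_x nested_enc R w x * bsc_n q x z = (2 ^+ n)^-1.
  under eq_bigr => w _ do rewrite PE.
  by rewrite -mulr_sumr (sum_coset_t _ linD) sum_bsc_n mulr1.
rewrite /wt_equiv_bsc exchange_big -sumrN mulr_sumr mulr_suml; apply: eq_bigr => z _.
rewrite -sumrN /shannon mulr_sumr mulr_suml; apply: eq_bigr => w _.
rewrite PZ PE mulf_eq0 (negbTE u0) /=; set p := \sum_(x in _) _.
have [->|_] := eqVneq p 0; first by rewrite mul0r !oppr0 mulr0 mul0r.
have -> : (2 ^+ n)^-1 * p / (2 ^+ n)^-1 = p by rewrite mulrAC mulfV // mul1r.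
by rewrite /log2 !mulrN mulNr !mulrA.
Qed.

Lemma wt_equiv_le (R : realType) (n : nat) (D : {set 'rV['F_2]_n}) (q : R) :
  is_linear_code D -> 0 <= q <= 1 ->
  wt_equiv_bsc q (@nested_enc n R D) <= ln #|{: coset_t D}|%:R / ln 2.
Proof.
move=> linD q01; rewrite wt_equiv_nested // ler_pM2r ?invr_gt0 ?ln_gt0 ?ltr1n //.
rewrite ler_pdivrMl ?exprn_gt0 //.
apply: (@le_trans _ _ (\sum_(z : 'rV['F_2]_n) ln #|{: coset_t D}|%:R)).
  apply: ler_sum => z _; apply: shannon_le => [w|].
    by apply: sumr_ge0 => x _; apply: bsc_n_ge0.
  by rewrite (sum_coset_t _ linD) sum_bsc_n.
by rewrite sumr_const card_mx card_Fp // mul1n -natrX mulr_natl.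
Qed.

(** For each output [z], [shannon_ge] is applied to the good and bad parts, with [u] the bound of
    [good_part_le]; the bad mass is [cover_prob C d] whatever [z] is. *)
Lemma wt_equiv_ge (R : realType) (n : nat) (C : {set 'rV['F_2]_n}) (q d s t : R) :
  is_linear_code C -> 0 <= d <= 1 -> `|s| <= 1 -> 0 <= t <= 1 ->
  d * s + (1 - d) * t = 1 - 2 * q ->
  ((1 - cover_prob C d) * (ln #|C|%:R - ln (1 + (1 - d) * t) *+ n)
    - cover_prob C d) / ln 2
  <= wt_equiv_bsc q (@nested_enc n R (dual_code C)).
Proof.
move=> linC d01 hs t01 e; have linD := dual_linear C.
have C_gt0 : 0 < #|C|%:R :> R.
  by rewrite ltr0n card_gt0; apply/set0Pn; exists 0; case: linC.
have /andP[t0 t1] := t01; have /andP[d0 d1] := d01.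
have ht : `|t| <= 1 by rewrite ger0_norm.
have g_gt0 : 0 < 1 + (1 - d) * t.
  by rewrite ltr_pwDl // mulr_ge0 // subr_ge0.
rewrite wt_equiv_nested // ler_pM2r ?invr_gt0 ?ln_gt0 ?ltr1n //.
rewrite ler_pdivlMl ?exprn_gt0 //.
(* [2 ^+ n] becomes the number of outputs [z], so that the bound is checked for each [z]. *)
rewrite -natrX -[X in (X ^ n)%N](card_Fp (p := 2)) // -[X in (_ ^ X)%N]mul1n -card_mx.
rewrite mulr_natl -sumr_const; apply: ler_sum => z _.
rewrite /shannon; under eq_bigr => w _ do rewrite (good_bad_split C (sval w) z e).
have part0 (P : pred {set 'I_n}) (A : {set 'rV['F_2]_n}) :
    0 <= \sum_(S | P S) pattern_prob d S * \sum_(x in A) noise_given s t S x z.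
  apply: sumr_ge0 => S _; rewrite mulr_ge0 ?pattern_prob_ge0 //.
  by apply: sumr_ge0 => x _; apply: noise_given_ge0.
have := @shannon_ge R (coset_t (dual_code C))
  (fun w => good_part C d s t (sval w) z) (fun w => bad_part C d s t (sval w) z)
  ((1 + (1 - d) * t) ^+ n / #|C|%:R).
rewrite sum_bad_part // ln_div ?posrE ?exprn_gt0 // lnXn //.
rewrite mulNr -mulrN opprB; apply.
- by move=> w; apply: part0.
- by move=> w; apply: part0.
- under eq_bigr => w _ do rewrite -(good_bad_split C (sval w) z e).
  by rewrite (sum_coset_t _ linD) sum_bsc_n.
- by rewrite divr_gt0 ?exprn_gt0.
- by case=> A hA /=; have /imsetP[v _ ->] := hA; apply: good_part_le.
Qed.

(** * Parameters near the erasure threshold *)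

(** If [e <= d], take [t = 0] and [s = e / d] (with [s = 0] if [d = 0], where [e = 0]). Otherwise
    [s = 1] forces [(1 - d) * t = e - d], at most [eta]. *)
Lemma split_parameters (R : realType) (e d eta : R) :
  0 <= e <= 1 -> 0 <= d <= 1 -> 0 <= eta -> e - eta <= d ->
  exists s t : R, [/\ `|s| <= 1, 0 <= t <= 1, d * s + (1 - d) * t = e
    & (1 - d) * t <= eta].
Proof.
move=> /andP[e0 e1] /andP[d0 d1] eta0 hd; have [ed|de] := leP e d.
  have [dz|d_neq0] := eqVneq d 0.
    by exists 0, 0; rewrite normr0 lexx ler01 !mulr0 addr0; split => //; lra.
  have d_gt0 : 0 < d by rewrite lt_neqAle eq_sym d_neq0.
  exists (e / d), 0; split; rewrite ?lexx ?ler01 ?mulr0 //.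
    by rewrite ger0_norm ?divr_ge0 // ler_pdivrMr // mul1r.
  by rewrite addr0 mulrC divfK.
have d'_gt0 : 0 < 1 - d by lra.
exists 1, ((e - d) / (1 - d)).
have tE : (1 - d) * ((e - d) / (1 - d)) = e - d by rewrite mulrC divfK ?gt_eqF.
split; rewrite ?normr1 ?tE //; try lra.
by rewrite divr_ge0 ?(ltW d'_gt0) ?subr_ge0 ?(ltW de) //= ler_pdivrMr // mul1r; lra.
Qed.

Lemma cover_prob_ge0 (R : realType) (n : nat) (C : {set 'rV['F_2]_n}) (d : R) :
  0 <= d <= 1 -> 0 <= cover_prob C d.
Proof. by move=> d01; apply: sumr_ge0 => S _; apply: pattern_prob_ge0. Qed.

Lemma cover_prob0 (R : realType) (n : nat) (C : {set 'rV['F_2]_n}) :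
  cover_prob C 0 = 0 :> R.
Proof.
apply: big1 => S /coverP[u [_ u0 hu]].
have [i iS] : exists i, i \in S.
  apply/existsP; apply: contraR u0; rewrite negb_exists => /forallP h.
  by apply/eqP/rowP => i; rewrite mxE hu.
by rewrite /pattern_prob (bigD1 i) //= iS mul0r.
Qed.

(** Eliminates [s] and [t] through [ln (1 + x) <= x]; the factor [1 - cover_prob C d], at most 1, is
    dropped from the subtracted term. *)
Lemma wt_equiv_ge_linear (R : realType) (n : nat) (C : {set 'rV['F_2]_n})
    (q d eta : R) :
  is_linear_code C -> 0 <= q <= 1 / 2 -> 0 <= d <= 1 -> 0 <= eta ->
  1 - 2 * q - eta <= d ->
  ((1 - cover_prob C d) * ln #|C|%:R - n%:R * eta - cover_prob C d) / ln 2
  <= wt_equiv_bsc q (@nested_enc n R (dual_code C)).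
Proof.
move=> linC /andP[q0 q1] d01 eta0 hd.
have e01 : 0 <= 1 - 2 * q <= 1 by apply/andP; split; lra.
have [s [t [hs t01 e hdt]]] := split_parameters e01 d01 eta0 hd.
apply: le_trans (wt_equiv_ge linC d01 hs t01 e).
rewrite ler_pM2r ?invr_gt0 ?ln_gt0 ?ltr1n // lerD2r mulrBr lerD2l lerN2.
have dt0 : 0 <= (1 - d) * t.
  by move: d01 t01 => /andP[? ?] /andP[? ?]; rewrite mulr_ge0 // subr_ge0.
have ln_ge0 : 0 <= ln (1 + (1 - d) * t) *+ n.
  by rewrite mulrn_wge0 // ln_ge0 // lerDl.
have cp0 := cover_prob_ge0 C d01.
apply: (@le_trans _ _ (ln (1 + (1 - d) * t) *+ n)).
  by rewrite ler_piMl // gerDl oppr_le0.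
rewrite -[leLHS]mulr_natl ler_wpM2l //; apply: le_trans hdt.
by apply: le_ln1Dx; lra.
Qed.

Lemma near_threshold (R : realType) (N : nat -> nat)
    (C : forall m, {set 'rV['F_2]_(N m)}) (eta : R) :
  (forall m, is_linear_code (C m)) -> 0 < eta ->
  exists d : R, [/\ 0 <= d <= 1, @erasure_threshold R N C - eta <= d
    & (fun m => cover_prob (C m) d) @ \oo --> (0 : R)]%classic.
Proof.
move=> linC eta0; rewrite /erasure_threshold; set E := (X in sup X).
have [E0|/set0P nE] := eqVneq E set0.
  (* The supremum of the empty set is 0 by convention, and at [d = 0] the pattern is almost surely
     empty and covers nothing. *)
  exists 0; rewrite E0 sup0 lexx ler01 sub0r oppr_le0 ltW //; split=> //.
  by under eq_fun do rewrite cover_prob0; apply: cvg_cst.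
have hE : has_sup E by split=> //; exists 1 => d [/andP[_]].
have [d [d01 errd] hd] := sup_adherent eta0 hE.
exists d; split=> //; first exact: ltW.
apply: (@squeeze_cvgr _ _ _ _ (fun=> 0) (fun m => 2 * ml_err (bec d) (C m))).
- by near=> m; rewrite cover_prob_ge0 //= cover_prob_le.
- exact: cvg_cst.
- by rewrite -(mulr0 2); apply: cvgM errd; apply: cvg_cst.
Unshelve. all: by end_near.
Qed.

(** * Reliability and the limiting equivocation rate *)

Lemma wt_err_nested (R : realType) (n : nat) (D : {set 'rV['F_2]_n}) :
  is_linear_code D -> wt_err_noiseless (@nested_enc n R D) (@nested_dec n D) = 0.
Proof.
move=> linD; rewrite /wt_err_noiseless big1 ?mulr0 // => w _.
apply: big1 => x _; rewrite /nested_enc (mem_coset_t _ _ linD).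
by case: eqVneq => _ /=; rewrite ?mulr0 ?mul0r.
Qed.

Theorem theorem3 (R : realType) (q : R) (N : nat -> nat)
    (C : forall m, {set 'rV['F_2]_(N m)}) (Rc : R) :
  0 <= q <= 1 / 2 ->
  @lin_code_seq R N C Rc ->
  @good_code_seq R N C Rc ->
  (1 - @erasure_threshold R N C) / 2 <= q ->
  @wt_achieves R q N
    (fun m => coset_t (dual_code (C m)))
    (fun m => @nested_enc (N m) R (dual_code (C m)))
    (fun m => @nested_dec (N m) (dual_code (C m)))
    Rc Rc.
Proof.
move=> q01 [Ninc [linC [k hk]]] [Rc_gt0 _] hq.
have ln2_gt0 : 0 < ln 2 :> R by rewrite ln_gt0 // ltr1n.
have lnC m : ln #|C m|%:R = Rc * (N m)%:R * ln 2.
  have [-> <-] := hk m.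
  by rewrite natrX lnXn ?ltr0n // [RHS]mulr_natl.
split=> //; split.
  by move=> m; rewrite /log2 card_coset_t_dual // lnC mulfK ?gt_eqF.
split.
  apply: cvg_near_cst; apply: nearW => m.
  by apply: wt_err_nested; apply: dual_linear.
exists Rc; split=> //; apply/cvgrPdist_le => eps eps0.
(* Half of [eps], converted to nats, pays for the distance to the threshold. *)
pose eta := eps / 2 * ln 2; have eta0 : 0 < eta by rewrite mulr_gt0 ?divr_gt0.
have [d [d01 hd cvd]] := near_threshold linC eta0.
(* A covering probability [c] costs at most [c * K] bits per symbol, kept below the other half of
   [eps]. *)
pose K := Rc + (ln 2)^-1; have K0 : 0 < K by rewrite addr_gt0 ?invr_gt0.
have del0 : 0 < eps / 2 / K by rewrite !divr_gt0.
(* The length [N 0] may be 0; strict growth gives positivity only from index 1 on. *)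
have N_gt0 m : (0 < m)%N -> (0 < N m)%N.
  by case: m => // m _; apply: leq_ltn_trans (Ninc m).
near=> m.
have Nm : 0 < (N m)%:R :> R by rewrite ltr0n N_gt0 //; near: m; exists 1%N.
have cov : cover_prob (C m) d <= eps / 2 / K.
  have : `|0 - cover_prob (C m) d| <= eps / 2 / K.
    by near: m; apply: (cvgrPdist_le (fun m => cover_prob (C m) d) 0).1.
  by rewrite sub0r normrN ger0_norm // cover_prob_ge0.
have cov0 := cover_prob_ge0 (C m) d01.
have q01' : 0 <= q <= 1 by move: q01 => /andP[? ?]; apply/andP; split; lra.
have up := wt_equiv_le (dual_linear (C m)) q01'.
rewrite card_coset_t_dual // lnC mulfK ?gt_eqF // in up.
have lo := @wt_equiv_ge_linear R (N m) (C m) q d eta (linC m) q01 d01 (ltW eta0).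
(* The hypothesis on [q] says that [1 - 2 * q] is at most the threshold, which is at most
   [d + eta]. *)
have {}lo := lo ltac:(lra).
rewrite lnC in lo; move: up lo; set H := wt_equiv_bsc _ _ => up lo.
have HN_le : H / (N m)%:R <= Rc by rewrite ler_pdivrMr.
(* The upper bound fixes the sign of the difference, so only the lower bound remains. *)
rewrite ger0_norm ?subr_ge0 // lerBlDr -lerBlDl ler_pdivlMr //.
apply: le_trans lo; rewrite ler_pdivlMr //.
set c := cover_prob _ _ in cov cov0 *.
have cK : c * K <= eps / 2 by rewrite -ler_pdivlMr.
have N1 : 1 <= (N m)%:R :> R by rewrite ler1n -(ltr0n R).
have KE : K * ln 2 = Rc * ln 2 + 1 by rewrite /K mulrDl mulVf ?gt_eqF.
have c1 : c * (Rc * ln 2 + 1) <= eps / 2 * ln 2.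
  by rewrite -KE mulrA ler_wpM2r // ltW.
have c2 : (N m)%:R * (c * (Rc * ln 2 + 1)) <= (N m)%:R * (eps / 2 * ln 2).
  by rewrite ler_wpM2l // ltW.
(* The additive loss [c] is absorbed into a term linear in the length. *)
have c3 : c <= (N m)%:R * c by rewrite ler_peMl.
rewrite /eta; nra.
Unshelve. all: by end_near.
Qed.
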